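(* Let $p,m,n\in\mathbb{N}_0$, $a,b>0$, $\alpha>-1$, and let $$\mathcal{L}(p,m,n;\alpha;a,b):=\int_0^\infty L_p^\alpha(x)L_m^\alpha(ax)L_n^\alpha(bx)\,x^\alpha e^{-x}\,dx.$$ Write $\mathcal{L}:=\mathcal{L}(p,m,n;\alpha;a,b)$, $\mathcal{L}_1^\pm:=\mathcal{L}(p\pm1,m,n;\alpha;a,b)$, $\mathcal{L}_2^\pm:=\mathcal{L}(p,m\pm1,n;\alpha;a,b)$, $\mathcal{L}_3^\pm:=\mathcal{L}(p,m,n\pm1;\alpha;a,b)$. Then $$a(p+\alpha)\mathcal{L}_1^--(m+\alpha)\mathcal{L}_2^-+(2m+\alpha+1)\mathcal{L}-a(2p+\alpha+1)\mathcal{L}-(m+1)\mathcal{L}_2^++a(p+1)\mathcal{L}_1^+=0,$$ $$b(p+\alpha)\mathcal{L}_1^--(n+\alpha)\mathcal{L}_3^-+(2n+\alpha+1)\mathcal{L}-b(2p+\alpha+1)\mathcal{L}-(n+1)\mathcal{L}_3^++b(p+1)\mathcal{L}_1^+=0,$$ $$b(m+\alpha)\mathcal{L}_2^--a(n+\alpha)\mathcal{L}_3^-+a(2n+\alpha+1)\mathcal{L}-b(2m+\alpha+1)\mathcal{L}-a(n+1)\mathcal{L}_3^++b(m+1)\mathcal{L}_2^+=0.$$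
   Context: $\mathbb{N}_0=\{0,1,2,\ldots\}$. The Laguerre polynomials are $L_n^\alpha(x)=\frac{(\alpha+1)_n}{n!}\sum_{j=0}^n\frac{(-n)_j}{(\alpha+1)_j}\frac{x^j}{j!}$ with $(z)_j=z(z+1)\cdots(z+j-1)$, and $L_{-1}^\alpha:=0$. *)

(* Defs.v *)
From HB Require Import structures.
From mathcomp Require Export all_boot all_order all_algebra.
From mathcomp Require Export all_classical all_reals all_analysis.

Set Implicit Arguments.
Unset Strict Implicit.
Unset Printing Implicit Defensive.

Import Order.TTheory GRing.Theory Num.Theory.
Import numFieldNormedType.Exports.

Local Open Scope classical_set_scope.
Local Open Scope ring_scope.

Definition pochhammer (R : realType) (z : R) (j : nat) : R :=
  \prod_(i < j) (z + i%:R).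

Definition laguerre_nat (R : realType) (alpha : R) (n : nat) (x : R) : R :=
  pochhammer (alpha + 1) n / n`!%:R *
  \sum_(j < n.+1)
     pochhammer (- n%:R) j / pochhammer (alpha + 1) j * (x ^+ j / j`!%:R).

(* The index is an integer so that L_(-1) = 0 is available; the zero value at
   indices below -1 is an extension of that convention. *)
Definition laguerre (R : realType) (alpha : R) (n : int) (x : R) : R :=
  if n is Posz k then laguerre_nat alpha k x else 0.

(* Lebesgue integral; the integrand is integrable whenever alpha > -1, whatever
   a, b and the indices are, so the value is never the default one. *)
Definition laguerre_triple (R : realType) (alpha a b : R) (p m n : int) : R :=
  \int[lebesgue_measure]_(x in `]0, +oo[)
     (laguerre alpha p x * laguerre alpha m (a * x) * laguerre alpha n (b * x)
      * (x `^ alpha) * expR (- x)).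

(* Main.v *)
(* The three-term recurrence expresses y * L_k^alpha(y) through L_(k+1), L_k and
   L_(k-1). Applied in each of the three factors, with y = x, y = a x and
   y = b x, it gives three expressions for 1, a and b times the same integral
   of x L_p(x) L_m(ax) L_n(bx) x^alpha e^(-x); eliminating that integral
   pairwise yields the three identities.

   Linearity of the integral requires x^k x^alpha e^(-x) to be integrable on
   (0, oo). It is dominated by a multiple of the derivative of
   (x / (1 + x))^(alpha + 1), which is integrable because its primitive is
   bounded; this handles the singularity at 0 and the tail at once. *)
Require Import Defs.
From mathcomp Require Import all_boot all_order all_algebra.
From mathcomp Require Import all_classical all_reals all_analysis.
From mathcomp Require Import ring lra.

Import Order.TTheory GRing.Theory Num.Theory.
Import numFieldNormedType.Exports measurable_realfun.
Local Open Scope ring_scope.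

(** * Integrability of polynomials against [x^alpha e^(-x)] on the half-line *)

Section Integrability.
Context {R : realType}.
Implicit Types (alpha x : R) (f F : R -> R).
Notation mu := (@lebesgue_measure R).
Local Open Scope classical_set_scope.

(** An exhaustion by compact intervals avoiding the possible singularity at 0. Starting at [n.+2]
    keeps every interval nondegenerate, as the fundamental theorem of calculus requires. *)
Lemma itv_0y_bigcup :
  `]0%R, +oo[ = \bigcup_n `[(n.+2%:R)^-1, n.+2%:R] :> set R.
Proof.
apply/seteqP; split => [x /=|x [n _]] /=; rewrite !in_itv/= ?andbT; last first.
  by move=> /andP[nx _]; rewrite (lt_le_trans _ nx)// invr_gt0 ltr0n.
(* This index plus 2 exceeds both [x] and [x^-1]. *)
move=> x0; exists (Num.truncn x + Num.truncn x^-1)%N => //=; rewrite in_itv/=.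
apply/andP; split.
  rewrite -[leRHS]invrK lef_pV2 ?posrE ?ltr0n ?invr_gt0//.
  by rewrite ltW// (lt_le_trans (truncnS_gt _))// ler_nat ltnS leqW ?leq_addl.
by rewrite ltW// (lt_le_trans (truncnS_gt _))// ler_nat ltnS leqW ?leq_addr.
Qed.

(** On each compact piece the integral of [f] is a difference of two values of [F], hence at most
    [M]; monotone convergence carries this bound to the whole half-line. *)
Lemma integrable_bounded_primitive f F (M : R) :
  (forall x, 0 < x -> 0 <= f x) -> {in `]0, +oo[, continuous f} ->
  (forall x, 0 < x -> is_derive x 1 F (f x)) ->
  (forall x, 0 < x -> 0 <= F x <= M) ->
  mu.-integrable `]0, +oo[ (EFin \o f).
Proof.
move=> f0 cf dF FM.
pose E n : set R := `[(n.+2%:R)^-1, n.+2%:R].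
have E0 n x : E n x -> 0 < x.
  rewrite /E/= in_itv/= => /andP[nx _].
  by rewrite (lt_le_trans _ nx)// invr_gt0 ltr0n.
have cfE n : {within E n, continuous f}.
  apply: continuous_in_subspaceT => x; rewrite inE => /E0 x0.
  by apply: cf; rewrite inE/= in_itv/= x0.
have mf : measurable_fun `](0 : R), +oo[ (EFin \o f).
  apply/measurable_EFinP; apply: open_continuous_measurable_fun.
    exact: interval_open.
  exact: cf.
apply/integrableP; split=> //.
have -> : (\int[mu]_(x in `]0%R, +oo[) `|(EFin \o f) x| =
           \int[mu]_(x in \bigcup_n E n) (f x)%:E)%E.
  rewrite itv_0y_bigcup; apply: eq_integral => x; rewrite inE => -[n _] /E0 x0.
  by rewrite /= ger0_norm ?f0.
apply: (@le_lt_trans _ _ M%:E); last exact: ltry.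
have := @ge0_nondecreasing_set_cvg_integral _ (measurableTypeR R) R E
  (EFin \o f) mu.
move=> /(_ _ _ _ _)/cvge_to_le; apply.
- move=> m n mn; apply/subsetPset/subset_itv; rewrite bnd_simp ?ler_nat//.
  by rewrite lef_pV2 ?posrE ?ltr0n// ler_nat.
- by move=> n; exact: measurable_itv.
- move=> n; apply: measurable_funS mf => // x /E0 x0.
  by rewrite /= in_itv/= x0.
- by move=> n x /E0 x0; rewrite lee_fin f0.
apply: nearW => n.
have cF x : 0 < x -> {for x, continuous F}.
  by move=> /dF ?; apply/differentiable_continuous/derivable1_diffP.
have n0 : 0 < (n.+2%:R)^-1 :> R by rewrite invr_gt0 ltr0n.
have n1 : (n.+2%:R)^-1 < n.+2%:R :> R.
  apply: (@lt_trans _ _ 1); last by rewrite ltr1n.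
  by rewrite invf_lt1 ?ltr0n// ltr1n.
rewrite (@continuous_FTC2 _ f F)//.
- rewrite -EFinB lee_fin.
  have /andP[F0 _] := FM _ n0; have /andP[_ FMn] := FM _ (lt_trans n0 n1).
  lra.
- exact: cfE.
- split.
  + move=> x /[!in_itv]/= /andP[/(lt_trans n0) x0 _].
    by have := dF _ x0.
  + by apply: cvg_at_right_filter; apply: cF.
  + by apply: cvg_at_left_filter; apply: cF; rewrite (lt_trans n0).
- move=> x /[!in_itv]/= /andP[/(lt_trans n0) x0 _].
  by rewrite derive1E; have [_ ->] := dF _ x0.
Qed.

Lemma exprn_le_fact_expR x n : 0 <= x -> x ^+ n <= n`!%:R * expR x.
Proof.
case: n => [|n] x0; first by rewrite expr0 fact0 mul1r -expR0 ler_expR.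
rewrite mulrC -ler_pdivrMr ?ltr0n ?fact_gt0//.
by apply: le_trans (expR_ge1Dxn n x0); rewrite lerDr.
Qed.

Let is_derive_quotient x : 0 < x ->
  is_derive x 1 (fun y => y / (1 + y)) ((1 + x) ^- 2).
Proof.
move=> x0; have x1 : 1 + x != 0 by rewrite lt0r_neq0// addr_gt0.
have d1 : derivable (fun y : R => 1 + y) x 1 by apply: derivableD.
have dV : derivable (fun y : R => (1 + y)^-1) x 1 by exact: (derivableV x1 d1).
have -> : (fun y => y / (1 + y)) = id * (fun y : R => (1 + y)^-1) by [].
apply: DeriveDef; first exact: derivableM.
rewrite deriveM// (deriveV x1 d1) deriveD// derive_cst derive_id add0r.
by rewrite /= /GRing.scale /=; field.
Qed.

Let is_derive_quotient_powR alpha x : 0 < x ->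
  is_derive x 1 (fun y => (y / (1 + y)) `^ (alpha + 1))
    ((alpha + 1) * (x / (1 + x)) `^ alpha * (1 + x) ^- 2).
Proof.
move=> x0; have q0 : 0 < x / (1 + x) by rewrite divr_gt0// addr_gt0.
have dq := is_derive_quotient _ x0; have dp := is_derive1_powR (alpha + 1) q0.
have := @is_derive1_comp _ (@powR R ^~ _) (fun y => y / (1 + y)) x _ _ dp dq.
by rewrite addrK.
Qed.

Let integrable_quotient_powR alpha : -1 < alpha ->
  mu.-integrable `]0, +oo[
    (EFin \o (fun x => (alpha + 1) * (x / (1 + x)) `^ alpha * (1 + x) ^- 2)).
Proof.
move=> alpha1; have a0 : 0 <= alpha + 1 by lra.
apply: (@integrable_bounded_primitive _
  (fun y => (y / (1 + y)) `^ (alpha + 1)) 1).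
- move=> x x0; rewrite !mulr_ge0 ?powR_ge0// invr_ge0 exprn_ge0//.
  by rewrite addr_ge0// ltW.
- move=> x; rewrite inE/= in_itv/= andbT => x0.
  have x1 : 0 < 1 + x by rewrite addr_gt0.
  have cq : {for x, continuous (fun y : R => (y / (1 + y)) `^ alpha)}.
    (* Differentiability gives continuity; the exponent [alpha - 1] is chosen so that the
       differentiated power is [alpha]. *)
    have [+ _] := is_derive_quotient_powR (alpha - 1) _ x0; rewrite subrK.
    by move=> /derivable1_diffP/differentiable_continuous.
  have c1 : {for x, continuous (fun y : R => 1 + y)}.
    by apply: cvgD; [exact: cvg_cst|exact: cvg_id].
  apply: cvgM; last first.
    apply: cvgV; first by rewrite lt0r_neq0// exprn_gt0.
    exact: (continuous_comp c1 (@exprn_continuous _ 2 _)).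
  apply: cvgM; first exact: cvg_cst.
  exact: cq.
- by move=> x x0; exact: is_derive_quotient_powR.
- move=> x x0; rewrite powR_ge0/=.
  apply: (@le_trans _ _ (1 `^ (alpha + 1))); last by rewrite powR1.
  have x1 : 0 < 1 + x by rewrite addr_gt0.
  rewrite ge0_ler_powR// ?nnegrE ?divr_ge0// ?ltW//.
  by rewrite ltr_pdivrMr//; lra.
Qed.

Lemma integrable_exprn_powR_expRN alpha k : -1 < alpha ->
  mu.-integrable `]0, +oo[
    (EFin \o (fun x => x ^+ k * (x `^ alpha * expR (- x)))).
Proof.
move=> alpha1; have a0 : 0 < alpha + 1 by lra.
(* [N] is a natural number above [alpha], so [(1 + x)^m] dominates [x^k (1 + x)^alpha (1 + x)^2],
   and is itself at most [m! e^(1 + x)]. The constant [C] collects [m!] and the surplus factor [e],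
   and cancels the [alpha + 1] of the derivative. *)
pose N := (Num.truncn alpha).+1.
pose m := (k + N + 2)%N.
pose C := m`!%:R * expR 1 / (alpha + 1).
have /(integrableZl _ C) := integrable_quotient_powR _ alpha1.
move=> /(_ (measurable_itv _)); apply: le_integrable => //.
  apply: measurable_funTS; apply/measurable_EFinP.
  apply: measurable_funM; first exact: exprn_measurable.
  apply: measurable_funM; first exact: measurable_powR.
  by apply: measurableT_comp; [exact: measurable_expR|exact: oppr_measurable].
move=> x /=; rewrite in_itv/= andbT => x0.
have x1 : 0 < 1 + x by rewrite addr_gt0.
have q0 : 0 < x / (1 + x) by rewrite divr_gt0.
rewrite lee_fin ger0_norm; last first.
  by rewrite !mulr_ge0 ?powR_ge0 ?expR_ge0// exprn_ge0// ltW.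
apply: le_trans (ler_norm _).
have -> : x `^ alpha = (x / (1 + x)) `^ alpha * (1 + x) `^ alpha.
  by rewrite -powRM ?divfK ?lt0r_neq0// ltW.
have le_pow : x ^+ k * (1 + x) `^ alpha * (1 + x) ^+ 2 <= m`!%:R * expR (1 + x).
  apply: le_trans (exprn_le_fact_expR _ m (ltW x1)).
  rewrite /m !exprD ler_wpM2r ?exprn_ge0 ?(ltW x1)//.
  apply: ler_pM; rewrite ?powR_ge0 ?exprn_ge0 ?(ltW x0)//.
    by apply: lerXn2r; rewrite ?nnegrE ?lerDr ?(ltW x1) ?(ltW x0).
  rewrite -powR_mulrn ?(ltW x1)// ler_powR ?lerDl ?(ltW x0)//.
  exact/ltW/truncnS_gt.
have -> : C * ((alpha + 1) * (x / (1 + x)) `^ alpha * (1 + x) ^- 2) =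
    (x / (1 + x)) `^ alpha * ((1 + x) ^- 2 * (m`!%:R * expR (1 + x)))
      * expR (- x).
  rewrite -[LHS]mulr1 -[X in _ * X = _](expRxMexpNx_1 x) expRD /C.
  by field; rewrite !lt0r_neq0.
rewrite [leLHS](_ : _ = (x / (1 + x)) `^ alpha *
  ((1 + x) ^- 2 * (x ^+ k * (1 + x) `^ alpha * (1 + x) ^+ 2)) * expR (- x)).
  rewrite ler_wpM2r ?expR_ge0// ler_wpM2l ?powR_ge0// ler_wpM2l//.
  by rewrite invr_ge0 exprn_ge0// ltW.
by field; rewrite lt0r_neq0.
Qed.

Lemma integrable_horner_powR_expRN alpha (p : {poly R}) : -1 < alpha ->
  mu.-integrable `]0, +oo[
    (EFin \o (fun x => p.[x] * (x `^ alpha * expR (- x)))).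
Proof.
move=> alpha1.
have -> : EFin \o (fun x => p.[x] * (x `^ alpha * expR (- x))) =
    (fun x => \sum_(i < size p)
       (p`_i)%:E * (x ^+ i * (x `^ alpha * expR (- x)))%:E)%E.
  apply/funext => x /=; rewrite horner_coef mulr_suml -sumEFin.
  by apply: eq_bigr => i _; rewrite -mulrA.
apply: integrable_sum => // i _.
by apply: integrableZl => //; exact: integrable_exprn_powR_expRN.
Qed.

End Integrability.

(** * Laguerre polynomials as formal polynomials, and their three-term recurrence *)

Section LaguerrePolynomial.
Context {R : realType}.
Implicit Types (alpha a x z : R) (n j : nat).

Lemma pochhammerS z j : pochhammer z j.+1 = pochhammer z j * (z + j%:R).
Proof. by rewrite /pochhammer big_ord_recr. Qed.

Lemma pochhammerSl z j : pochhammer z j.+1 = z * pochhammer (z + 1) j.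
Proof.
rewrite /pochhammer big_ord_recl addr0; congr (_ * _).
by apply: eq_bigr => i _; rewrite /= /bump add1n -natr1; ring.
Qed.

Lemma pochhammer_gt0 z j : 0 < z -> 0 < pochhammer z j.
Proof. by move=> z0; apply: prodr_gt0 => i _; rewrite ltr_wpDr. Qed.

Lemma pochhammer_oppn n j : (n < j)%N -> pochhammer (- n%:R : R) j = 0.
Proof.
move=> nj; rewrite /pochhammer (bigD1 (Ordinal nj)) //=.
by rewrite addNr mul0r.
Qed.

Definition laguerre_coef alpha n j : R :=
  pochhammer (alpha + 1) n / n`!%:R *
  (pochhammer (- n%:R) j / (pochhammer (alpha + 1) j * j`!%:R)).

Definition laguerre_poly alpha (k : int) : {poly R} :=
  if k is Posz n then \poly_(j < n.+1) laguerre_coef alpha n j else 0.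

Lemma laguerre_polyE alpha k x :
  laguerre alpha k x = (laguerre_poly alpha k).[x].
Proof.
case: k => n /=; last by rewrite horner0.
rewrite /laguerre_nat horner_poly mulr_sumr; apply: eq_bigr => j _.
by rewrite /laguerre_coef invfM; ring.
Qed.

(** Beyond the degree, [(-n)_j] contains the factor 0, so one formula covers all [j] and the
    recurrence can be compared coefficientwise without bounds on [j]. *)
Lemma coef_laguerre_poly alpha n j :
  (laguerre_poly alpha n)`_j = laguerre_coef alpha n j.
Proof.
rewrite coef_poly; case: ltnP => // nj.
by rewrite /laguerre_coef pochhammer_oppn// !(mul0r, mulr0).
Qed.

Lemma pochhammer_fact_succ alpha n :
  (n%:R + 1) * (pochhammer (alpha + 1) n.+1 / n.+1`!%:R) =
  (alpha + 1 + n%:R) * (pochhammer (alpha + 1) n / n`!%:R).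
Proof.
rewrite pochhammerS factS natrM -natr1.
have := natr1 (R := R) n; have : n.+1%:R != 0 :> R by rewrite pnatr_eq0.
have : n`!%:R != 0 :> R by rewrite pnatr_eq0 -lt0n fact_gt0.
by move=> f0 n0 nE; field; rewrite f0 nE n0.
Qed.

(** Brings the lower neighbour to the normalising factor of index [n]. At [n = 0] the left side
    vanishes because [L_(-1) = 0], the right side because of the factor [n]. *)
Lemma pred_laguerre_coef alpha n j :
  (n%:R + alpha) * (laguerre_poly alpha (n%:Z - 1))`_j =
  n%:R * (pochhammer (alpha + 1) n / n`!%:R) *
  (pochhammer (1 - n%:R) j / (pochhammer (alpha + 1) j * j`!%:R)).
Proof.
case: n => [|n]; first by rewrite sub0r coef0 mulr0 !mul0r.
have -> : n.+1%:Z - 1 = n by rewrite -addn1 PoszD addrK.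
rewrite coef_laguerre_poly /laguerre_coef.
have -> : 1 - n.+1%:R = - n%:R :> R by rewrite -natr1; ring.
by rewrite mulrA -natr1 pochhammer_fact_succ; congr (_ * _ * _); ring.
Qed.

(* Factoring out [pochhammer (- n) j] reduces the recurrence for the
   coefficients to a polynomial identity in [n], [j] and [alpha]. *)
Lemma laguerre_poly_recurrence alpha n : -1 < alpha ->
  (n%:R + 1) *: laguerre_poly alpha (n%:Z + 1)
    + (n%:R + alpha) *: laguerre_poly alpha (n%:Z - 1)
    - (2 * n%:R + alpha + 1) *: laguerre_poly alpha n
  = - ('X * laguerre_poly alpha n).
Proof.
move=> alpha1; apply/polyP => j.
have -> : n%:Z + 1 = n.+1 by rewrite -addn1 PoszD.
rewrite coefB coefD !coefZ coefN coefXM pred_laguerre_coef !coef_laguerre_poly.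
rewrite /laguerre_coef [(n%:R + 1) * _]mulrA pochhammer_fact_succ.
set A := _ / n`!%:R.
have a1 : 0 < alpha + 1 by lra.
have -> : - n.+1%:R = - n%:R - 1 :> R by rewrite -natr1; ring.
(* The constant coefficient is separate: multiplication by ['X] contributes nothing there. *)
case: j => [|j] /=.
  by rewrite /pochhammer !big_ord0 fact0; field.
have [d0 f0] : pochhammer (alpha + 1) j != 0 /\ j`!%:R != 0 :> R.
  by rewrite lt0r_neq0 ?pochhammer_gt0// pnatr_eq0 -lt0n fact_gt0.
have j0 : j%:R + 1 != 0 :> R by rewrite natr1 pnatr_eq0.
have aj0 : alpha + 1 + j%:R != 0 by rewrite lt0r_neq0// ltr_wpDr.
(* Absorbing [-n] as a new first factor turns [(1 - n)_(j+1)] into [(-n)_(j+2)], whose last two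
   factors are then split off. *)
have nE : n%:R * pochhammer (1 - n%:R) j.+1 =
    - (pochhammer (- n%:R) j * (- n%:R + j%:R) * (- n%:R + j%:R + 1)) :> R.
  have -> : 1 - n%:R = - n%:R + 1 :> R by ring.
  by rewrite -[n%:R * _]opprK -mulNr -pochhammerSl !pochhammerS -natr1 addrA.
rewrite (mulrC n%:R A) -[A * n%:R * _]mulrA [n%:R * (_ / _)]mulrA nE.
rewrite pochhammerSl subrK !pochhammerS factS natrM -natr1.
by field; rewrite f0 j0 aj0 d0.
Qed.

End LaguerrePolynomial.

(** * The linear functional on polynomials defined by the weight *)

Section WeightedIntegral.
Context {R : realType} (alpha : R) (alpha_gtN1 : -1 < alpha).
Implicit Types (c : R) (p q : {poly R}) (n : nat).

(** The moment functional of the gamma weight: for [alpha > -1] its value at ['X^k] is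
    [Gamma(k + alpha + 1)]. *)
Definition gamma_integral p : R :=
  \int[lebesgue_measure]_(x in `]0, +oo[) (p.[x] * (x `^ alpha * expR (- x))).

Lemma gamma_integralD p q :
  gamma_integral (p + q) = gamma_integral p + gamma_integral q.
Proof.
rewrite /gamma_integral -RintegralD//; try exact: integrable_horner_powR_expRN.
by apply: eq_Rintegral => x _; rewrite hornerD mulrDl.
Qed.

Lemma gamma_integralZ c p : gamma_integral (c *: p) = c * gamma_integral p.
Proof.
rewrite /gamma_integral -RintegralZl//; last first.
  exact: integrable_horner_powR_expRN.
by apply: eq_Rintegral => x _; rewrite hornerZ -mulrA.
Qed.

Lemma laguerre_tripleE a b (k l m : int) :
  laguerre_triple alpha a b k l m =
  gamma_integral (laguerre_poly alpha k * (laguerre_poly alpha l \Po (a *: 'X))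
                    * (laguerre_poly alpha m \Po (b *: 'X))).
Proof.
apply: eq_Rintegral => x _.
by rewrite !hornerM !horner_comp hornerZ hornerX !laguerre_polyE hornerZ
  hornerX !mulrA.
Qed.

(** The recurrence is composed with [c *: 'X], multiplied by [q] and integrated. Keeping [c] and [q]
    free lets one statement serve all three factors, [q] being the product of the other two. *)
Lemma gamma_integral_laguerre_recurrence c q n :
  (n%:R + 1) *
      gamma_integral ((laguerre_poly alpha (n%:Z + 1) \Po (c *: 'X)) * q)
    + (n%:R + alpha) *
      gamma_integral ((laguerre_poly alpha (n%:Z - 1) \Po (c *: 'X)) * q)
    - (2 * n%:R + alpha + 1) *
      gamma_integral ((laguerre_poly alpha n \Po (c *: 'X)) * q)
  = - c * gamma_integral ('X * ((laguerre_poly alpha n \Po (c *: 'X)) * q)).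
Proof.
rewrite -mulNr -!gamma_integralZ -!gamma_integralD.
congr gamma_integral; rewrite !scalerAl -!mulrDl.
have := congr1 (comp_poly (c *: 'X))
  (laguerre_poly_recurrence alpha n alpha_gtN1).
rewrite comp_polyB comp_polyD !comp_polyZ raddfN -[X in _ = - X]/(_ \Po _).
rewrite comp_polyM comp_polyX.
by rewrite scaleNr => ->; rewrite scaleNr !mulNr mulrA.
Qed.

End WeightedIntegral.

Theorem theorem7p6 (R : realType) (p m n : nat) (a b alpha : R)
    (ha : 0 < a) (hb : 0 < b) (halpha : -1 < alpha) :
  let L := laguerre_triple alpha a b p m n in
  let L1m := laguerre_triple alpha a b (p%:Z - 1) m n in
  let L1p := laguerre_triple alpha a b (p%:Z + 1) m n in
  let L2m := laguerre_triple alpha a b p (m%:Z - 1) n in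
  let L2p := laguerre_triple alpha a b p (m%:Z + 1) n in
  let L3m := laguerre_triple alpha a b p m (n%:Z - 1) in
  let L3p := laguerre_triple alpha a b p m (n%:Z + 1) in
  [/\ a * (p%:R + alpha) * L1m - (m%:R + alpha) * L2m
        + (2 * m%:R + alpha + 1) * L - a * (2 * p%:R + alpha + 1) * L
        - (m%:R + 1) * L2p + a * (p%:R + 1) * L1p = 0,
      b * (p%:R + alpha) * L1m - (n%:R + alpha) * L3m
        + (2 * n%:R + alpha + 1) * L - b * (2 * p%:R + alpha + 1) * L
        - (n%:R + 1) * L3p + b * (p%:R + 1) * L1p = 0
    & b * (m%:R + alpha) * L2m - a * (n%:R + alpha) * L3m
        + a * (2 * n%:R + alpha + 1) * L - b * (2 * m%:R + alpha + 1) * L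
        - a * (n%:R + 1) * L3p + b * (m%:R + 1) * L2p = 0].
Proof.
move=> L L1m L1p L2m L2p L3m L3p.
pose Q c (k : nat) := laguerre_poly alpha k \Po (c *: 'X).
pose M := gamma_integral alpha ('X * (laguerre_poly alpha p * Q a m * Q b n)).
have E1 : (p%:R + 1) * L1p + (p%:R + alpha) * L1m
    - (2 * p%:R + alpha + 1) * L = - M.
  (* The unscaled factor is the case [c = 1], where the composition is with ['X] itself. *)
  have := gamma_integral_laguerre_recurrence _ halpha 1 (Q a m * Q b n) p.
  by rewrite scale1r !comp_polyXr !mulrA -!laguerre_tripleE mulN1r /M !mulrA.
have E2 : (m%:R + 1) * L2p + (m%:R + alpha) * L2m
    - (2 * m%:R + alpha + 1) * L = - a * M.
  have := gamma_integral_laguerre_recurrence _ halpha a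
    (laguerre_poly alpha p * Q b n) m.
  by rewrite !(mulrCA (_ \Po (a *: 'X))) !mulrA -!laguerre_tripleE /M !mulrA.
have E3 : (n%:R + 1) * L3p + (n%:R + alpha) * L3m
    - (2 * n%:R + alpha + 1) * L = - b * M.
  have := gamma_integral_laguerre_recurrence _ halpha b
    (laguerre_poly alpha p * Q a m) n.
  by rewrite !(mulrC (_ \Po (b *: 'X))) -!laguerre_tripleE.
(* [M] cancels in the combinations [a E1 - E2], [b E1 - E3] and [b E2 - a E3]. *)
clearbody L L1m L1p L2m L2p L3m L3p M; split.
- by have := congr1 ( *%R a) E1; lra.
- by have := congr1 ( *%R b) E1; lra.
- by have := congr1 ( *%R a) E3; have := congr1 ( *%R b) E2; lra.
Qed.
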